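(* Let $\mathrm{BP}$ be a binary program in $n$ variables with constraints $Ax\leq b$, $x\in\{0,1\}^n$, where $A\in\mathbb{R}^{m\times n}$, $b\in\mathbb{R}^m$ and $\operatorname{Fes}(\mathrm{BP})\neq\emptyset$. Suppose that for each $\bar{x}\in\operatorname{Fes}(\mathrm{BP})$ there exists $\bar{y}\in\operatorname{Fes}(\mathrm{BP})$ such that $\bar{x}+\bar{y}\leq e$. Let $a^{T}x\leq a_{0}$ define a facet of $P^{n}_{\mathrm{BP}}$. Then $\hat{a}^{T}(x\oplus y\oplus z)\leq a_{0}$ is a facet defining inequality of $P^{n}_{\overline{\mathrm{BPD}}}$ for $\hat{a}=a\oplus 0\oplus 0$ and for $\hat{a}=0\oplus a\oplus 0$.
   Context: $\operatorname{Fes}(\mathrm{BP})=\{x\in\{0,1\}^n: Ax\leq b\}$ and $P^{n}_{\mathrm{BP}}=\operatorname{conv}(\operatorname{Fes}(\mathrm{BP}))\subseteq\mathbb{R}^n$. $e$ is the all-ones vector, inequalities between vectors are entrywise, and $\oplus$ denotes concatenation of vectors. The diameter polytope is $P^{n}_{\overline{\mathrm{BPD}}}=\operatorname{conv}\{x\oplus y\oplus z\in\{0,1\}^{3n}: Ax\leq b,\ Ay\leq b,\ x+y-z\leq e\}\subseteq\mathbb{R}^{3n}$. The dimension of a nonempty polytope is the dimension of its affine hull. If $a^Tx\leq a_0$ is a valid inequality for a polytope $P$, the face it defines is $\{x\in P: a^Tx=a_0\}$; a facet of $P$ is a face of dimension $\dim P-1$, and an inequality defines a facet (is facet defining) if it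 is valid for $P$ and the face it defines is a facet. *)

(* Defs.v *)
From HB Require Import structures.
From mathcomp Require Import all_boot all_order all_algebra.
From mathcomp Require Import boolp classical_sets reals convex.

Set Implicit Arguments.
Unset Strict Implicit.
Unset Printing Implicit Defensive.

Import Order.TTheory GRing.Theory Num.Theory.

Local Open Scope classical_set_scope.
Local Open Scope ring_scope.

Section Hulls.
Context {R : realType} {E : lmodType R}.

Definition conv_hull (S : set E) : set E :=
  smallest (@convex_set R E) S.

Definition affine_set (M : set E) : Prop :=
  forall (x y : E) (t : R), M x -> M y -> M (t *: x + (1 - t) *: y).

Definition affine_hull (S : set E) : set E := smallest affine_set S.

End Hulls.

Section Vectors.
Context {R : realType} {n : nat}.
Implicit Types (u v x : 'cV[R]_n) (P : set 'cV[R]_n).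

Definition vec_le u v : Prop := forall i, u i 0 <= v i 0.

Definition binary x : Prop := forall i, x i 0 = 0 \/ x i 0 = 1.

Definition dotp u v : R := (u^T *m v) 0 0.

(* The affine hull of P is a translate x0 + V with \dim V = d. This never
   holds for P = set0, whose affine hull is empty: the empty set has no
   dimension, and in particular is not a facet. *)
Definition has_dim P (d : nat) : Prop :=
  exists (x0 : 'cV[R]_n) (V : {vspace 'cV[R]_n}),
    affine_hull P = [set x | x - x0 \in V] /\ \dim V = d.

Definition valid_ineq P a a0 : Prop := forall x, P x -> dotp a x <= a0.

Definition face P a a0 : set 'cV[R]_n := [set x | P x /\ dotp a x = a0].

Definition facet_defining P a a0 : Prop :=
  valid_ineq P a a0 /\
  exists d : nat, has_dim P d.+1 /\ has_dim (face P a a0) d.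

End Vectors.

Section BinaryProgram.
Context {R : realType} {m n : nat}.
Variables (A : 'M[R]_(m, n)) (b : 'cV[R]_m).

Definition concat3 (x y z : 'cV[R]_n) : 'cV[R]_(n + (n + n)) :=
  col_mx x (col_mx y z).

Definition Fes : set 'cV[R]_n := [set x | binary x /\ vec_le (A *m x) b].

Definition polytope_BP : set 'cV[R]_n := conv_hull Fes.

Definition polytope_BPD : set 'cV[R]_(n + (n + n)) :=
  conv_hull [set w | exists x y z : 'cV[R]_n,
    w = concat3 x y z /\ binary w /\
    [/\ vec_le (A *m x) b, vec_le (A *m y) b
      & vec_le (x + y - z) (const_mx 1)]].

End BinaryProgram.

(* Main.v *)
Require Import Defs.
From mathcomp Require Import all_boot all_order all_algebra.
From mathcomp Require Import boolp classical_sets reals convex.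
From mathcomp Require Import interval_inference.

(** Both polytopes are convex hulls of explicit point sets, so dimensions can
    be computed on generators: [conv_hull S] has the same affine hull as [S],
    and the face of [conv_hull S] cut out by a valid inequality has the same
    affine hull as the generators lying on it ([facet_defining_conv_hullP]).

    The generators of the diameter polytope are the points
    x (+) y (+) z with x, y feasible and z a binary vector covering the overlap
    of x and y; the generators on the face given by a (+) 0 (+) 0 (resp.
    0 (+) a (+) 0) are those where moreover x (resp. y) lies on the face of the
    original program. All these sets have the form [cover_lift S T], and the
    heart of the proof is that the affine hull of [cover_lift S T] is the whole
    product aff S x aff T x R^n ([affine_hull_cover_lift]). Indeed z = e covers
    every overlap, which gives aff S x aff T x {e}; and over one disjoint pair
    (x0, y0) the component z is arbitrary, which frees the last factor. The
    hypothesis on the program supplies such a pair, even with x0 (or y0) on the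
    given face, which is nonempty since it has a dimension. Hence, if the face
    has dimension d and the original polytope d + 1, then the diameter polytope
    has dimension 2 (d + 1) + n, and its two faces have dimension
    d + (d + 1) + n. *)

Set Implicit Arguments.
Unset Strict Implicit.
Unset Printing Implicit Defensive.

Import Order.TTheory GRing.Theory Num.Theory.

Local Open Scope classical_set_scope.
Local Open Scope ring_scope.

(** * Affine and convex hulls *)

Section AffineHull.
Context {R : realType} {E : lmodType R}.
Implicit Types (S M : set E).

Lemma affine_hull_affine S : affine_set (affine_hull S).
Proof.
move=> x y t Sx Sy M [aM SM]; apply: (aM); first exact: Sx.
exact: Sy.
Qed.

Lemma affine_combxx (t : R) (x : E) : t *: x + (1 - t) *: x = x.
Proof. by rewrite -scalerDl addrC subrK scale1r. Qed.

(** The fourth vertex of a parallelogram is the affine combination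
    2 m - r of one vertex r and the midpoint m of the opposite diagonal. *)
Lemma affine_set_parallelogram M p q r :
  affine_set M -> M p -> M q -> M r -> M (p + q - r).
Proof.
move=> aM Mp Mq Mr.
have -> : p + q - r = 2 *: (2^-1 *: p + (1 - 2^-1) *: q) + (1 - 2) *: r.
  have -> : 1 - 2^-1 = 2^-1 :> R.
    by rewrite {1}[1]splitr mul1r addrK.
  rewrite -scalerDr scalerA divff ?pnatr_eq0 // scale1r.
  by rewrite opprD addrA subrr add0r scaleN1r.
exact: aM (aM _ _ _ Mp Mq) Mr.
Qed.

Lemma convex_setP S :
  (forall x y (t : R), 0 <= t <= 1 -> S x -> S y -> S (t *: x + (1 - t) *: y)) ->
  convex_set S.
Proof.
move=> cS x y t /set_mem Sx /set_mem Sy; apply: mem_set.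
apply: cS => //.
by rewrite ge0 le1.
Qed.

Lemma affine_convex_set M : affine_set M -> convex_set M.
Proof. by move=> aM; apply: convex_setP => x y t _; apply: aM. Qed.

Lemma affine_hull_conv_hull S : affine_hull (conv_hull S) = affine_hull S.
Proof.
apply/seteqP; split; apply: smallest_sub; try exact: affine_hull_affine.
  apply: smallest_sub; last exact: sub_gen_smallest.
  by apply: affine_convex_set; apply: affine_hull_affine.
by apply: subset_trans (@sub_gen_smallest _ _ _); apply: sub_gen_smallest.
Qed.

End AffineHull.

(** * Dimension and facets in terms of generators *)

Section Dimension.
Context {R : realType} {n : nat}.
Implicit Types (S P : set 'cV[R]_n) (M : set 'cV[R]_n) (x y : 'cV[R]_n).

(** Factored out of [has_dim], so that an affine hull already identified as a
    product of flats can be measured directly: [has_dim P d] is convertible to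
    [flat_dim (affine_hull P) d]. *)
Definition flat_dim M (d : nat) : Prop :=
  exists (x0 : 'cV[R]_n) (V : {vspace 'cV[R]_n}),
    M = [set x | x - x0 \in V] /\ \dim V = d.

Lemma dotp_comb a (t s : R) x y :
  dotp a (t *: x + s *: y) = t * dotp a x + s * dotp a y.
Proof. by rewrite /dotp mulmxDr -!scalemxAr !mxE. Qed.

Lemma has_dim_nonempty P d : has_dim P d -> P !=set0.
Proof.
move=> [x0 [V [defV _]]]; apply/set0P/eqP => P0.
suff: affine_hull P x0 by move=> /(_ set0); apply; split; rewrite ?P0.
by rewrite defV /= subrr mem0v.
Qed.

Lemma valid_ineq_conv_hull S a a0 :
  valid_ineq (conv_hull S) a a0 <-> valid_ineq S a a0.
Proof.
split=> vS; first by move=> x Sx; apply: vS; apply: sub_gen_smallest.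
suff: conv_hull S `<=` [set x | dotp a x <= a0] by [].
apply: smallest_sub => //; apply: convex_setP => x y t /andP[t0 t1] /= lx ly.
rewrite dotp_comb (_ : a0 = t * a0 + (1 - t) * a0).
  by rewrite lerD // ler_wpM2l // subr_ge0.
by rewrite -mulrDl addrC subrK mul1r.
Qed.

(** Enlarging the face to the set of points that satisfy the inequality, and
    lie in the affine hull of the tight generators as soon as they are tight,
    yields a convex set: a proper convex combination is tight only if both its
    ends are. *)
Lemma face_conv_hull_sub S a a0 : valid_ineq S a a0 ->
  face (conv_hull S) a a0 `<=` affine_hull (face S a a0).
Proof.
move=> vS.
pose C := [set x | dotp a x <= a0 /\
                   (dotp a x = a0 -> affine_hull (face S a a0) x)].
suff SC : conv_hull S `<=` C by move=> x [/SC[_ Cx] /Cx].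
apply: smallest_sub; last first.
  by move=> x Sx; split=> [|xa]; [exact: vS | apply: sub_gen_smallest].
apply: convex_setP => x y t /andP[t0 t1] [lx hx] [ly hy].
have [->|tN0] := eqVneq t 0; first by rewrite scale0r add0r subr0 scale1r.
have [->|tN1] := eqVneq t 1; first by rewrite subrr scale0r addr0 scale1r.
have t_gt0 : 0 < t by rewrite lt_def tN0.
have t_lt1 : 0 < 1 - t by rewrite subr_gt0 lt_def eq_sym tN1.
have a0E : a0 = t * a0 + (1 - t) * a0.
  by rewrite -mulrDl addrC subrK mul1r.
have ltx : t * dotp a x <= t * a0 by rewrite ler_pM2l.
have lty : (1 - t) * dotp a y <= (1 - t) * a0 by rewrite ler_pM2l.
rewrite /C /= dotp_comb; split; first by rewrite [leRHS]a0E lerD.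
move=> /eqP tight; apply: affine_hull_affine.
  apply: hx; apply/(mulfI tN0)/eqP; rewrite eq_le ltx /=.
  rewrite -(lerD2r ((1 - t) * a0)) -a0E -[leLHS](eqP tight).
  by rewrite lerD2l.
apply: hy; apply/(mulfI (lt0r_neq0 t_lt1))/eqP; rewrite eq_le lty /=.
by rewrite -(lerD2l (t * a0)) -a0E -[leLHS](eqP tight) lerD2r.
Qed.

Lemma affine_hull_face_conv_hull S a a0 : valid_ineq S a a0 ->
  affine_hull (face (conv_hull S) a a0) = affine_hull (face S a a0).
Proof.
move=> vS; apply/seteqP; split; apply: smallest_sub.
- exact: affine_hull_affine.
- exact: face_conv_hull_sub.
- exact: affine_hull_affine.
- move=> x [Sx xa]; apply: sub_gen_smallest; split=> //.
  by apply: sub_gen_smallest.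
Qed.

Lemma facet_defining_conv_hullP S a a0 :
  facet_defining (conv_hull S) a a0 <-> facet_defining S a a0.
Proof.
rewrite /facet_defining valid_ineq_conv_hull.
suff E d : valid_ineq S a a0 ->
    (has_dim (conv_hull S) d = has_dim S d) *
    (has_dim (face (conv_hull S) a a0) d = has_dim (face S a a0) d).
  by split=> -[vS [d [Hd Hf]]]; split=> //; exists d; move: Hd Hf; rewrite !E.
by move=> vS; rewrite /has_dim affine_hull_conv_hull affine_hull_face_conv_hull.
Qed.

(** Being affine and containing 0, the hull is a linear subspace, and the
    binary vectors include the standard basis. *)
Lemma affine_hull_binary : affine_hull (@binary R n) = setT.
Proof.
apply/seteqP; split=> // z _ M [aM BM].
have M0 : M 0 by apply: BM => i; left; rewrite mxE.
have -> : z = \sum_i z i 0 *: delta_mx i 0.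
  rewrite {1}[z]matrix_sum_delta; apply: eq_bigr => i _.
  by rewrite big_ord1.
elim/big_ind: _ => // [x y Mx My|i _].
  by rewrite -[x + y]subr0; apply: affine_set_parallelogram.
rewrite -[_ *: _]addr0 -(scaler0 _ (1 - z i 0)); apply: aM => //.
apply: BM => j; rewrite mxE andbT.
by case: (j == i); [right | left].
Qed.

Lemma flat_dim_setT : flat_dim setT n.
Proof.
exists 0, fullv; split; last by rewrite dimvf /dim /= muln1.
by apply/seteqP; split=> // x _ /=; rewrite memvf.
Qed.

End Dimension.

(** * Products *)

Section Products.
Context {R : realType} {p q : nat}.

Definition col_prod (S : set 'cV[R]_p) (T : set 'cV[R]_q) : set 'cV[R]_(p + q) :=
  [set w | S (usubmx w) /\ T (dsubmx w)].

Lemma col_prodE S T x y : col_prod S T (col_mx x y) = (S x /\ T y).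
Proof. by rewrite /col_prod /= col_mxKu col_mxKd. Qed.

Definition col_inl : 'Hom('cV[R]_p, 'cV[R]_(p + q)) :=
  linfun (mulmx (col_mx 1%:M 0)).

Definition col_inr : 'Hom('cV[R]_q, 'cV[R]_(p + q)) :=
  linfun (mulmx (col_mx 0 1%:M)).

Lemma col_inlE x : col_inl x = col_mx x 0.
Proof. by rewrite lfunE /= mul_col_mx mul1mx mul0mx. Qed.

Lemma col_inrE y : col_inr y = col_mx 0 y.
Proof. by rewrite lfunE /= mul_col_mx mul1mx mul0mx. Qed.

Lemma flat_dim_col_prod (M : set 'cV[R]_p) (N : set 'cV[R]_q) d e :
  flat_dim M d -> flat_dim N e -> flat_dim (col_prod M N) (d + e).
Proof.
move=> [x0 [V [-> <-]]] [y0 [W [-> <-]]].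
exists (col_mx x0 y0), (col_inl @: V + col_inr @: W)%VS; split.
  apply/seteqP; split=> w;
    rewrite -[w]vsubmxK col_prodE /= opp_col_mx add_col_mx.
    move=> [Vw Ww].
    rewrite -[X in col_mx X _]addr0 -[X in col_mx _ X]add0r -add_col_mx.
    by rewrite -col_inlE -col_inrE memv_add // memv_img.
  move=> /memv_addP[_ /memv_imgP[u Vu ->] [_ /memv_imgP[v Wv ->]]].
  rewrite col_inlE col_inrE add_col_mx addr0 add0r.
  by move=> /eq_col_mx[-> ->].
rewrite dimv_disjoint_sum; last first.
  apply/eqP; rewrite -subv0; apply/subvP => _
    /memv_capP[/memv_imgP[u _ ->] /memv_imgP[v _]].
  by rewrite col_inlE col_inrE => /eq_col_mx[u0 _]; rewrite u0 col_mx0 mem0v.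
congr (_ + _)%N; apply: limg_dim_eq; rewrite (eqP (_ : lker _ == 0%VS)) ?capv0 //.
  by apply/lker0P => u v; rewrite !col_inlE => /eq_col_mx[].
by apply/lker0P => u v; rewrite !col_inrE => /eq_col_mx[].
Qed.

End Products.

(** * Covered pairs of binary vectors *)

Section CoverLift.
Context {R : realType} {n : nat}.
Implicit Types (S T : set 'cV[R]_n) (x y z : 'cV[R]_n).

(** For binary vectors, the inequality says that z is 1 wherever x and y are
    both 1. Allowing S and T to differ makes the faces of interest instances of
    the same construction. *)
Definition cover_lift S T : set 'cV[R]_(n + (n + n)) :=
  [set w | exists x y z, w = concat3 x y z /\
    [/\ S x, T y, binary z & vec_le (x + y - z) (const_mx 1)]].

Lemma concat3_comb (t s : R) x y z x' y' z' :
  t *: concat3 x y z + s *: concat3 x' y' z' =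
  concat3 (t *: x + s *: x') (t *: y + s *: y') (t *: z + s *: z').
Proof. by rewrite /concat3 !scale_col_mx !add_col_mx. Qed.

Lemma affine_set_slice (M : set 'cV[R]_(n + (n + n))) x y z : affine_set M ->
  [/\ affine_set [set u | M (concat3 u y z)],
      affine_set [set u | M (concat3 x u z)] &
      affine_set [set u | M (concat3 x y u)]].
Proof.
by move=> aM; split=> u v t /= Mu Mv;
   have := aM _ _ t Mu Mv; rewrite concat3_comb !affine_combxx.
Qed.

Lemma binary_le1 x : binary x -> vec_le x (const_mx 1).
Proof. by move=> bx i; rewrite mxE; case: (bx i) => ->; rewrite ?ler01. Qed.

Lemma binary_ge0 x : binary x -> forall i, 0 <= x i 0.
Proof. by move=> bx i; case: (bx i) => ->; rewrite ?ler01. Qed.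

(** For the nontrivial inclusion, write (x, y, z) as
    (x, y, e) + (x0, y0, z) - (x0, y0, e), where e is the all-ones vector: the
    first and last points are reached because e covers every overlap, the second
    one because x0 and y0 have no overlap to cover. *)
Lemma affine_hull_cover_lift S T x0 y0 :
  S `<=` @binary R n -> T `<=` @binary R n ->
  S x0 -> T y0 -> vec_le (x0 + y0) (const_mx 1) ->
  affine_hull (cover_lift S T) =
  col_prod (affine_hull S) (col_prod (affine_hull T) setT).
Proof.
move=> bS bT Sx0 Ty0 dxy; apply/seteqP; split.
  apply: smallest_sub => [u v t [Su [Tu _]] [Sv [Tv _]]|
    _ [x [y [z [-> [Sx Ty _ _]]]]]].
    by rewrite /col_prod /= !linearP !linearZ /=;
      do ?split=> //; apply: affine_hull_affine.
  rewrite /concat3 !col_prodE.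
  by do ?split=> //; apply: sub_gen_smallest.
move=> w [Sw [Tw _]] M [aM LM].
rewrite -[w]vsubmxK -[dsubmx w]vsubmxK.
move: (usubmx w) (usubmx (dsubmx w)) (dsubmx (dsubmx w)) Sw Tw => x y z Sx Ty.
have Mxye x' y' : affine_hull S x' -> affine_hull T y' ->
    M (concat3 x' y' (const_mx 1)).
  move=> Sx' Ty'.
  (* pass from generators to hulls one component at a time, the slices of M
     being affine *)
  have [_ a2 _] := affine_set_slice x' 0 (const_mx 1) aM.
  apply: (Ty' [set u | M (concat3 x' u (const_mx 1))]); split=> // v Tv /=.
  have [a1 _ _] := affine_set_slice 0 v (const_mx 1) aM.
  apply: (Sx' [set u | M (concat3 u v (const_mx 1))]); split=> // u Su /=.
  apply: LM; exists u, v, (const_mx 1); split=> //; split=> // i.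
    by right; rewrite mxE.
  have := binary_le1 (bS _ Su) i; have := binary_le1 (bT _ Tv) i.
  by rewrite !mxE lerBlDr => ? ?; rewrite lerD.
have Mz z' : M (concat3 x0 y0 z').
  have [_ _ a3] := affine_set_slice x0 y0 0 aM.
  have : affine_hull (@binary R n) z' by rewrite affine_hull_binary.
  move=> /(_ [set u | M (concat3 x0 y0 u)]); apply; split=> // u bu /=.
  apply: LM; exists x0, y0, u; do !split=> //.
  move=> i; apply: le_trans (dxy i).
  by rewrite [leLHS]mxE [X in _ + X]mxE gerDl oppr_le0 binary_ge0.
have := affine_set_parallelogram aM (Mxye _ _ Sx Ty) (Mz z) (Mz (const_mx 1)).
rewrite /concat3 opp_col_mx !add_col_mx opp_col_mx add_col_mx.
by rewrite !addrK [const_mx 1 + z]addrC addrK.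
Qed.

Lemma has_dim_cover_lift S T x0 y0 d e :
  S `<=` @binary R n -> T `<=` @binary R n ->
  S x0 -> T y0 -> vec_le (x0 + y0) (const_mx 1) ->
  has_dim S d -> has_dim T e -> has_dim (cover_lift S T) (d + (e + n)).
Proof.
move=> bS bT Sx0 Ty0 dxy dS dT.
rewrite /has_dim (affine_hull_cover_lift bS bT Sx0 Ty0 dxy).
exact: flat_dim_col_prod dS (flat_dim_col_prod dT flat_dim_setT).
Qed.

Lemma dotp_concat3 a a' a'' x y z :
  dotp (concat3 a a' a'') (concat3 x y z) = dotp a x + dotp a' y + dotp a'' z.
Proof. by rewrite /dotp /concat3 !tr_col_mx !mul_row_col !mxE addrA. Qed.

Lemma dotp0 x : dotp 0 x = 0.
Proof. by rewrite /dotp trmx0 mul0mx mxE. Qed.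

Lemma dotp_concat3l a x y z : dotp (concat3 a 0 0) (concat3 x y z) = dotp a x.
Proof. by rewrite dotp_concat3 !dotp0 !addr0. Qed.

Lemma dotp_concat3m a x y z : dotp (concat3 0 a 0) (concat3 x y z) = dotp a y.
Proof. by rewrite dotp_concat3 !dotp0 addr0 add0r. Qed.

Lemma face_cover_liftl S T a a0 :
  face (cover_lift S T) (concat3 a 0 0) a0 = cover_lift (face S a a0) T.
Proof.
apply/seteqP; split=> w.
  move=> [[x [y [z [-> [Sx Ty bz c]]]]]]; rewrite dotp_concat3l => xa.
  by exists x, y, z.
move=> [x [y [z [-> [[Sx xa] Ty bz c]]]]]; split; last by rewrite dotp_concat3l.
by exists x, y, z.
Qed.

Lemma face_cover_liftm S T a a0 :
  face (cover_lift S T) (concat3 0 a 0) a0 = cover_lift S (face T a a0).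
Proof.
apply/seteqP; split=> w.
  move=> [[x [y [z [-> [Sx Ty bz c]]]]]]; rewrite dotp_concat3m => ya.
  by exists x, y, z.
move=> [x [y [z [-> [Sx [Ty ya] bz c]]]]]; split; last by rewrite dotp_concat3m.
by exists x, y, z.
Qed.

Lemma binary_concat3 x y z :
  binary (concat3 x y z) <-> [/\ binary x, binary y & binary z].
Proof.
split=> [bw|[bx by_ bz] i].
  split=> i.
  - by have := bw (lshift _ i); rewrite col_mxEu.
  - by have := bw (rshift _ (lshift _ i)); rewrite col_mxEd col_mxEu.
  - by have := bw (rshift _ (rshift _ i)); rewrite col_mxEd col_mxEd.
rewrite /concat3; case: (split_ordP i) => j ->; rewrite ?col_mxEu ?col_mxEd //.
by case: (split_ordP j) => k ->; rewrite ?col_mxEu ?col_mxEd.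
Qed.

Lemma polytope_BPD_cover_lift m (A : 'M[R]_(m, n)) (b : 'cV[R]_m) :
  polytope_BPD A b = conv_hull (cover_lift (Fes A b) (Fes A b)).
Proof.
congr conv_hull; apply/seteqP; split=> w [x [y [z]]].
  by move=> [-> [/binary_concat3[bx by_ bz] [Ax Ay c]]]; exists x, y, z.
move=> [-> [[bx Ax] [by_ Ay] bz c]]; exists x, y, z.
by split=> //; split=> //; apply/binary_concat3.
Qed.

End CoverLift.

(** * The two lifted facets *)

Theorem theorem2p11 (R : realType) (m n : nat)
  (A : 'M[R]_(m, n)) (b : 'cV[R]_m)
  (Fes_neq0 : Fes A b !=set0)
  (disjoint_feasible : forall x : 'cV[R]_n, Fes A b x ->
     exists y : 'cV[R]_n, Fes A b y /\ vec_le (x + y) (const_mx 1))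
  (a : 'cV[R]_n) (a0 : R)
  (facet_a : facet_defining (polytope_BP A b) a a0) :
  facet_defining (polytope_BPD A b) (concat3 a 0 0) a0 /\
  facet_defining (polytope_BPD A b) (concat3 0 a 0) a0.
Proof.
move: facet_a => /facet_defining_conv_hullP[valid [d [dimP dimF]]].
have [x0 Fx0] := has_dim_nonempty dimF.
have [Sx0 _] := Fx0.
have [y0 [Sy0 xy0]] := disjoint_feasible x0 Sx0.
have yx0 : vec_le (y0 + x0) (const_mx 1) by rewrite addrC.
have binS : Fes A b `<=` @binary R n by move=> x [].
have binF : face (Fes A b) a a0 `<=` @binary R n by move=> x [/binS].
have dimL := has_dim_cover_lift binS binS Sx0 Sy0 xy0 dimP dimP.
rewrite polytope_BPD_cover_lift; split; apply/facet_defining_conv_hullP; split.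
- by move=> _ [x [y [z [-> [Sx _ _ _]]]]]; rewrite dotp_concat3l valid.
- exists (d + (d.+1 + n))%N; split; first exact: dimL.
  rewrite face_cover_liftl.
  exact: has_dim_cover_lift binF binS Fx0 Sy0 xy0 dimF dimP.
- by move=> _ [x [y [z [-> [_ Sy _ _]]]]]; rewrite dotp_concat3m valid.
- exists (d.+1 + (d + n))%N; split; first by move: dimL; rewrite addSn addnS.
  rewrite face_cover_liftm.
  exact: has_dim_cover_lift binS binF Sy0 Fx0 yx0 dimP dimF.
Qed.
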